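(* Let $L\in C^1(\mathbb{R}^n)$ be bounded below, let $c\in\mathbb{R}$ satisfy $\inf_{\mathbb{R}^n}(L+c)>0$, and put $l=\sqrt{L+c}$. Let $(\theta_k,r_k)_{k\ge 0}$ be generated by the AEPG iteration $$v_k=T_k\nabla l(\theta_k),\qquad r_{k+1}=\frac{r_k}{1+2\eta\|v_k\|^2},\qquad \theta_{k+1}=\theta_k-2\eta r_{k+1}v_k ,$$ with $\theta_0\in\mathbb{R}^n$, $r_0>0$ and preconditioning matrices $T_k\in\mathbb{R}^{n\times n}$. Then AEPG is unconditionally energy stable: for any step size $\eta>0$ and all $k\ge 0$, $$r_{k+1}^2=r_k^2-(r_{k+1}-r_k)^2-\frac1\eta\|\theta_{k+1}-\theta_k\|^2 .$$ This implies that $r_k$ is strictly decreasing and converges to a limit $r^*$ as $k\to\infty$. Furthermore $$\sum_{k=0}^\infty\|\theta_{k+1}-\theta_k\|^2\le \eta r_0^2,\qquad\text{hence}\qquad \lim_{k\to\infty}\|\theta_{k+1}-\theta_k\|=0 .$$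
   Context: $\|\cdot\|$ is the Euclidean norm. The parameter set is all of $\mathbb{R}^n$ (unconstrained case). AEPG stands for adaptive preconditioned gradient descent with energy. The default initialization of the method is $r_0=l(\theta_0)$.
   Formalization: Strict decrease of r_k fails when some v_k = 0 (e.g. T_k = 0); the formal theorem states that r_k is nonincreasing, that r_{k+1} < r_k exactly when v_k ≠ 0, and that r_k is strictly decreasing if no v_k vanishes. *)

(* Defs.v *)
From HB Require Import structures.
From mathcomp Require Import all_boot all_order all_algebra.
From mathcomp Require Import all_classical all_reals all_analysis.

Set Implicit Arguments.
Unset Strict Implicit.
Unset Printing Implicit Defensive.

Import Order.TTheory GRing.Theory Num.Theory.
Import numFieldNormedType.Exports.

Local Open Scope classical_set_scope.
Local Open Scope ring_scope.

(* Points of R^n are column vectors. The library norm on matrices is the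
   max-norm, so the Euclidean norm is defined here; the topologies agree. *)
Definition enorm (R : realType) (n : nat) (x : 'cV[R]_n) : R :=
  Num.sqrt (\sum_(i < n) x i 0 ^+ 2).

Definition grad (R : realType) (n : nat) (f : 'cV[R]_n -> R) (x : 'cV[R]_n) :
    'cV[R]_n :=
  \col_(i < n) 'D_(delta_mx i 0) f x.

Definition C1 (R : realType) (n : nat) (f : 'cV[R]_n -> R) : Prop :=
  (forall x, differentiable f x) /\ continuous (grad f).

(* The AEPG iteration for the square-root objective [l], step size [eta] and
   preconditioners [T]. The matrices [T k] are arbitrary, so they may depend on
   the whole past of the iteration. *)
Record AEPG (R : realType) (n : nat) (l : 'cV[R]_n -> R) (eta : R)
    (T : nat -> 'M[R]_n) (v theta : nat -> 'cV[R]_n) (r : nat -> R) : Prop := {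
  AEPG_v : forall k, v k = T k *m grad l (theta k);
  AEPG_r : forall k, r k.+1 = r k / (1 + 2 * eta * enorm (v k) ^+ 2);
  AEPG_theta : forall k,
    theta k.+1 = theta k - (2 * eta * r k.+1) *: v k
}.

(* Main.v *)
(* Writing the update of r as r_k - r_{k+1} = 2 eta r_{k+1} |v_k|^2 and the one
   of theta as |theta_{k+1} - theta_k|^2 = 4 eta^2 r_{k+1}^2 |v_k|^2, the energy
   identity is that of 2 a (a - b) = a^2 - b^2 + (a - b)^2. Its last term is then
   at most r_k^2 - r_{k+1}^2, which telescopes. *)
Require Import Defs.
From HB Require Import structures.
From mathcomp Require Import all_boot all_order all_algebra.
From mathcomp Require Import all_classical all_reals all_analysis.
From mathcomp Require Import ring lra.

Set Implicit Arguments.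
Unset Strict Implicit.
Unset Printing Implicit Defensive.

Import Order.TTheory GRing.Theory Num.Theory.
Import numFieldNormedType.Exports.

Local Open Scope classical_set_scope.
Local Open Scope ring_scope.

Lemma sqr_enorm (R : realType) (n : nat) (x : 'cV[R]_n) :
  enorm x ^+ 2 = \sum_(i < n) x i 0 ^+ 2.
Proof. by rewrite sqr_sqrtr// sumr_ge0// => i _; exact: sqr_ge0. Qed.

Lemma enorm_ge0 (R : realType) (n : nat) (x : 'cV[R]_n) : 0 <= enorm x.
Proof. exact: sqrtr_ge0. Qed.

Lemma enorm_gt0 (R : realType) (n : nat) (x : 'cV[R]_n) :
  0 < enorm x ^+ 2 <-> x <> 0.
Proof.
have s0 : 0 <= enorm x ^+ 2 by exact: sqr_ge0.
split=> [/[swap] -> | xN0].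
  by rewrite sqr_enorm big1 ?ltxx// => i _; rewrite mxE expr0n.
(* Were the sum of squares zero, each of its nonnegative terms would vanish, forcing [x = 0]. *)
rewrite lt_neqAle s0 andbT; apply/negP; rewrite eq_sym sqr_enorm.
rewrite psumr_eq0 => [/allP x0|i _]; last exact: sqr_ge0.
apply: xN0; apply/matrixP => i j; rewrite (ord1 j) mxE; apply/eqP.
by rewrite -sqrf_eq0; exact: (x0 i (mem_index_enum i)).
Qed.

Lemma sqr_enormZ (R : realType) (n : nat) (a : R) (x : 'cV[R]_n) :
  enorm (a *: x) ^+ 2 = a ^+ 2 * enorm x ^+ 2.
Proof.
by rewrite !sqr_enorm mulr_sumr; apply: eq_bigr => i _; rewrite mxE exprMn.
Qed.

Section bounded_series.
Variables (R : realType) (u : nat -> R) (M : R).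
Hypothesis u_ge0 : forall k, 0 <= u k.
Hypothesis u_sum_le : forall N, \sum_(0 <= k < N) u k <= M.

Lemma nneseries_le_bound : (\sum_(0 <= k <oo) (u k)%:E <= M%:E)%E.
Proof.
apply: lime_le; first by apply: is_cvg_nneseries => k _ _; rewrite lee_fin.
by apply: nearW => N; rewrite sumEFin lee_fin.
Qed.

(** The partial sums are nondecreasing and bounded by [M], so the series converges and its terms
    tend to zero. *)
Lemma bounded_nonneg_series_cvg0 : u @ \oo --> (0 : R).
Proof.
apply: cvg_series_cvg_0; apply: nondecreasing_is_cvgn.
  exact: nondecreasing_series.
by exists M => _ [N _ <-]; exact: u_sum_le.
Qed.

End bounded_series.

Section energy.
Variables (R : realType) (n : nat) (l : 'cV[R]_n -> R) (eta : R).
Variables (T : nat -> 'M[R]_n) (v theta : nat -> 'cV[R]_n) (r : nat -> R).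
Hypotheses (eta_gt0 : 0 < eta) (r0_gt0 : 0 < r 0%N).
Hypothesis aepg : AEPG l eta T v theta r.

(** Positivity for every [eta > 0] is what makes the stability unconditional: no step size can spoil
    the division. *)
Let den_gt0 k : 0 < 1 + 2 * eta * enorm (v k) ^+ 2.
Proof. by rewrite ltr_pwDl// mulr_ge0 ?sqr_ge0// mulr_ge0// ltW. Qed.

Lemma AEPG_r_gt0 k : 0 < r k.
Proof. by elim: k => // k rk; rewrite (AEPG_r aepg) divr_gt0. Qed.

(** Clearing the denominator expresses [r k] through [r k.+1], which turns the later claims into
    polynomial ones. *)
Lemma AEPG_r_step k : r k = r k.+1 + 2 * eta * r k.+1 * enorm (v k) ^+ 2.
Proof.
have <- : r k.+1 * (1 + 2 * eta * enorm (v k) ^+ 2) = r k.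
  by rewrite (AEPG_r aepg) divfK// gt_eqF.
by ring.
Qed.

Lemma AEPG_r_nonincreasing k : r k.+1 <= r k.
Proof.
rewrite [leRHS]AEPG_r_step lerDl mulr_ge0 ?sqr_ge0//.
by rewrite !mulr_ge0// ltW// AEPG_r_gt0.
Qed.

(** The drop of [r] is [2 * eta * r k.+1] times the squared norm of [v k], with a positive first
    factor; [r] stalls exactly when [v k] vanishes. *)
Lemma AEPG_r_lt k : r k.+1 < r k <-> v k <> 0.
Proof.
by rewrite [ltRHS]AEPG_r_step ltrDl pmulr_rgt0 ?enorm_gt0// !mulr_gt0 ?AEPG_r_gt0.
Qed.

Lemma AEPG_energy k : r k.+1 ^+ 2 = r k ^+ 2 - (r k.+1 - r k) ^+ 2
  - eta^-1 * enorm (theta k.+1 - theta k) ^+ 2.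
Proof.
have -> : theta k.+1 - theta k = (- (2 * eta * r k.+1)) *: v k.
  by rewrite (AEPG_theta aepg) addrC addKr scaleNr.
(* With [s = r k.+1], [w] the squared norm of [v k] and [d = 2 * eta * s * w], the claim is [s^2 =
   (s + d)^2 - d^2 - 4 * eta * s^2 * w]. *)
rewrite sqr_enormZ (AEPG_r_step k); field.
by rewrite gt_eqF.
Qed.

Lemma AEPG_step_sum_le N :
  \sum_(0 <= k < N) enorm (theta k.+1 - theta k) ^+ 2 <= eta * r 0%N ^+ 2.
Proof.
(* The term [r N ^+ 2] is kept so that the induction telescopes, and is dropped only at the end. *)
suff : \sum_(0 <= k < N) enorm (theta k.+1 - theta k) ^+ 2
    <= eta * (r 0%N ^+ 2 - r N ^+ 2).
  by move=> /le_trans; apply; rewrite ler_pM2l// gerBl sqr_ge0.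
elim: N => [|N IH]; first by rewrite big_geq// subrr mulr0.
rewrite big_nat_recr//=.
(* The energy identity solved for the squared step; the subtracted square only helps the bound. *)
have -> : enorm (theta N.+1 - theta N) ^+ 2 =
    eta * (r N ^+ 2 - r N.+1 ^+ 2) - eta * (r N.+1 - r N) ^+ 2.
  by rewrite (AEPG_energy N); field; rewrite gt_eqF.
have := mulr_ge0 (ltW eta_gt0) (sqr_ge0 (r N.+1 - r N)).
by move: IH; lra.
Qed.

Lemma AEPG_r_cvg : exists rstar : R, r @ \oo --> rstar.
Proof.
(* A nonincreasing sequence bounded below, here by 0, converges to its infimum. *)
exists (inf (range r)); apply: nonincreasing_cvgn.
  exact/nonincreasing_seqP/AEPG_r_nonincreasing.
by exists 0 => _ [k _ <-]; rewrite ltW// AEPG_r_gt0.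
Qed.

Lemma AEPG_step_cvg0 :
  (fun k => enorm (theta k.+1 - theta k)) @ \oo --> (0 : R).
Proof.
have sq0 := bounded_nonneg_series_cvg0 (fun k => sqr_ge0 _) AEPG_step_sum_le.
(* The squared steps tend to 0 by summability. Writing the limit as the root of 0 and each norm as
   the root of its square lets continuity of the square root conclude. *)
rewrite -[X in _ --> X](@sqrtr0 R).
under eq_fun do rewrite -[enorm _]ger0_norm ?enorm_ge0// -sqrtr_sqr.
by apply: continuous_cvg sq0; exact: sqrt_continuous.
Qed.

End energy.

Theorem theorem2p1 (R : realType) (n : nat) (L : 'cV[R]_n -> R) (c : R)
    (L_C1 : C1 L)
    (L_bounded_below : has_lbound (range L))
    (c_large : 0 < inf (range (fun x => L x + c)))
    (eta : R) (eta_gt0 : 0 < eta)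
    (T : nat -> 'M[R]_n) (v theta : nat -> 'cV[R]_n) (r : nat -> R)
    (r0_gt0 : 0 < r 0%N)
    (aepg : AEPG (fun x => Num.sqrt (L x + c)) eta T v theta r) :
  (forall k, r k.+1 ^+ 2 =
     r k ^+ 2 - (r k.+1 - r k) ^+ 2
       - eta^-1 * enorm (theta k.+1 - theta k) ^+ 2)
  /\ ((forall k, v k <> 0) -> decreasing_seq r)
  /\ (forall k, r k.+1 <= r k)
  /\ (forall k, r k.+1 < r k <-> v k <> 0)
  /\ (exists rstar : R, r @ \oo --> rstar)
  /\ (\sum_(0 <= k <oo) (enorm (theta k.+1 - theta k) ^+ 2)%:E
        <= (eta * r 0%N ^+ 2)%:E)%E
  /\ (fun k => enorm (theta k.+1 - theta k)) @ \oo --> (0 : R).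
Proof.
split; first exact: (AEPG_energy eta_gt0 aepg).
split.
  move=> vN0; apply/decreasing_seqP => k.
  exact/(AEPG_r_lt eta_gt0 r0_gt0 aepg).
split; first exact: (AEPG_r_nonincreasing eta_gt0 r0_gt0 aepg).
split; first exact: (AEPG_r_lt eta_gt0 r0_gt0 aepg).
split; first exact: (AEPG_r_cvg eta_gt0 r0_gt0 aepg).
split; last exact: (AEPG_step_cvg0 eta_gt0 aepg).
apply: nneseries_le_bound => [k|]; first exact: sqr_ge0.
exact: (AEPG_step_sum_le eta_gt0 aepg).
Qed.
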